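(* For every integer $d\geq 1$ there exists a function $f_d:\mathbb{N}\to\mathbb{N}$ such that the following holds. Let $F=\{X_1,\dots,X_m\}$ be a family of finite sets in $\mathbb{R}^d$. If \[\varphi\Big(\bigcup_{i\in I}X_i\Big)\geq f_d(|I|)\] for every non-empty subset $I\subset\{1,\dots,m\}$, then $F$ has a system of general position representatives.
   Context: A subset $X\subset\mathbb{R}^d$ is in general position if every subset of $X$ of size at most $d+1$ is affinely independent. For a finite set $X\subset\mathbb{R}^d$, $\varphi(X)$ denotes the maximal size of a subset of $X$ in general position. For a family $F=\{X_1,\dots,X_m\}$ of finite sets in $\mathbb{R}^d$, a system of general position representatives is a set $\{x_1,\dots,x_m\}$ in general position (in particular consisting of $m$ distinct points) with $x_i\in X_i$ for all $1\le i\le m$. *)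

(* Defs.v *)
From mathcomp Require Import all_boot all_order all_algebra finmap.
From mathcomp Require Import boolp reals.

Set Implicit Arguments.
Unset Strict Implicit.
Unset Printing Implicit Defensive.

Import GRing.Theory.
Local Open Scope ring_scope.
Local Open Scope fset_scope.

Section GeneralPosition.
Context {R : realType} {d : nat}.
Implicit Types S X Y : {fset 'rV[R]_d}.

Definition affinely_independent S : Prop :=
  forall c : 'rV[R]_d -> R,
    \sum_(x <- S) c x = 0 -> \sum_(x <- S) c x *: x = 0 ->
    forall x, x \in S -> c x = 0.

Definition general_position X : Prop :=
  forall S, S `<=` X -> (#|` S| <= d.+1)%N -> affinely_independent S.

Definition phi X : nat :=
  (\max_(Y <- fpowerset X | `[< general_position Y >]) #|` Y|)%N.

Definition has_general_position_representatives
    (m : nat) (X : 'I_m -> {fset 'rV[R]_d}) : Prop :=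
  exists x : 'I_m -> 'rV[R]_d,
    [/\ forall i, x i \in X i,
        injective x
      & general_position [fset x i | i in 'I_m]].

End GeneralPosition.

(* Main.v *)
Require Import Defs.
From mathcomp Require Import all_boot all_order all_algebra finmap.
From mathcomp Require Import boolp reals.

Set Implicit Arguments.
Unset Strict Implicit.
Unset Printing Implicit Defensive.

Import GRing.Theory.
Local Open Scope ring_scope.
Local Open Scope fset_scope.

(** A family of sets can be ordered so that greedy selection works.  Since
[phi] is subadditive, if [phi] of the union of [k] sets is at least [k * N]
then one of the sets has [phi >= N]; put that set last and recurse on the
others.  When its turn comes, [k - 1] points [Y] have been chosen, and a new
point is forbidden only if it lies in the affine span of some [S] contained in
[Y] with at most [d] points.  Such a span meets a set in general position in
at most [d] points, so [N = 2 ^ k * d + 1] leaves room for a choice. *)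

Lemma card_bigfcup_le (I : Type) (T : choiceType) (r : seq I) (P : pred I)
    (F : I -> {fset T}) :
  (#|` \bigcup_(i <- r | P i) F i| <= \sum_(i <- r | P i) #|` F i|)%N.
Proof.
elim/big_rec2: _ => [|i k A _ le_A]; first by rewrite cardfs0.
by rewrite (leq_trans (leq_card_fsetU _ _)) // leq_add2l.
Qed.

Lemma exists_fsubset_card (T : choiceType) (A : {fset T}) (k : nat) :
  (k <= #|` A|)%N -> exists2 B, B `<=` A & #|` B| = k.
Proof.
move=> le_kA; exists [fset x in take k A].
  by apply/fsubsetP=> x; rewrite inE => /mem_take.
by rewrite card_fseq undup_id ?take_uniq // size_takel.
Qed.

Section GeneralPositionTheory.
Context {R : realType} {d : nat}.
Implicit Types (S X Y Z : {fset 'rV[R]_d}) (z : 'rV[R]_d).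

(** * Affine spans and affine independence *)

Definition in_affine_span S z : Prop :=
  exists2 a : 'rV[R]_d -> R,
    \sum_(x <- S) a x = 1 & \sum_(x <- S) a x *: x = z.

Lemma mem_affine_span1 z : in_affine_span [fset z] z.
Proof. by exists (fun=> 1); rewrite big_seq_fset1 // scale1r. Qed.

(* A nonzero left kernel vector of the coefficient matrix would be an affine
dependency of [Z]. *)
Lemma card_affine_span_le S Z :
  affinely_independent Z -> (forall z, z \in Z -> in_affine_span S z) ->
  (#|` Z| <= #|` S|)%N.
Proof.
move=> indZ spanZ; rewrite leqNgt; apply/negP => ltSZ.
have /choice[a aP] z : exists a : 'rV[R]_d -> R, z \in Z ->
    \sum_(x <- S) a x = 1 /\ \sum_(x <- S) a x *: x = z.
  have [/spanZ[a a1 az]|] := boolP (z \in Z); first by exists a.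
  by exists (fun=> 0).
pose A := \matrix_(i < size Z, j < size S) a Z`_i S`_j.
(* [A] has more rows than columns, so its rows are linearly dependent. *)
have /rowV0Pn[v /sub_kermxP vA v0] : kermx A != 0.
  by rewrite kermx_eq0 /row_free neq_ltn (leq_ltn_trans (rank_leq_col _)).
(* [c] carries the entries of [v] over to the points of [Z], with default value 0 elsewhere. *)
pose c z := if insub (index z Z) is Some i then v 0 i else 0.
have cE (i : 'I_(size Z)) : c Z`_i = v 0 i.
  by rewrite /c index_uniq ?fset_uniq // valK.
have c0 x : x \in S -> \sum_(z <- Z) c z * a z x = 0.
  move=> xS; have lt_x : (index x S < size S)%N by rewrite index_mem.
  move/matrixP/(_ 0 (Ordinal lt_x)): vA; rewrite !mxE => vAx.
  rewrite -[RHS]vAx (big_nth 0) big_mkord; apply: eq_bigr => i _.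
  by rewrite cE mxE /= nth_index.
have sum_c : \sum_(z <- Z) c z = 0.
  transitivity (\sum_(z <- Z) \sum_(x <- S) c z * a z x).
    apply: eq_big_seq => z /aP[a1 _].
    by rewrite -mulr_sumr a1 mulr1.
  by rewrite exchange_big big_seq big1.
have sum_cz : \sum_(z <- Z) c z *: z = 0.
  transitivity (\sum_(z <- Z) \sum_(x <- S) (c z * a z x) *: x).
    apply: eq_big_seq => z /aP[_ az].
    rewrite -[X in _ *: X = _]az scaler_sumr; apply: eq_bigr => x _.
    exact: scalerA.
  rewrite exchange_big big_seq big1 // => x xS.
  by rewrite -scaler_suml c0 // scale0r.
case/negP: v0; apply/eqP/rowP => i; rewrite mxE -cE.
by apply: indZ => //; apply: mem_nth.
Qed.

Lemma affinely_independentU1 S z :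
  affinely_independent S -> ~ in_affine_span S z ->
  affinely_independent (z |` S).
Proof.
move=> indS zNS c.
have zS : z \notin S.
  (* A point of [S] lies in the span of [S], with the indicator of that point as weights. *)
  apply/negP=> zS; apply: zNS; exists (fun x => (x == z)%:R).
    rewrite (big_rem z) //= eqxx big_seq big1 ?addr0 // => x.
    by rewrite mem_rem_uniq ?fset_uniq // inE => /andP[/negPf->].
  rewrite (big_rem z) //= eqxx scale1r big_seq big1 ?addr0 // => x.
  by rewrite mem_rem_uniq ?fset_uniq // inE => /andP[/negPf->]; rewrite scale0r.
rewrite !big_fsetU1 //= => sum_c sum_cx.
have cz0 : c z = 0.
  apply/eqP/negPn/negP => cz; apply: zNS; exists (fun x => - (c z)^-1 * c x).
    rewrite -mulr_sumr (_ : \sum_(x <- S) c x = - c z) ?mulrNN ?mulVf //.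
    by apply/eqP; rewrite -addr_eq0 addrC sum_c.
  under eq_bigr do rewrite -scalerA.
  rewrite -scaler_sumr (_ : \sum_(x <- S) c x *: x = - (c z *: z)).
    by rewrite scalerN scaleNr opprK scalerA mulVf // scale1r.
  by apply/eqP; rewrite -addr_eq0 addrC sum_cx.
move: sum_c sum_cx; rewrite cz0 scale0r !add0r => sum_c sum_cx x.
by rewrite in_fset1U => /predU1P[->//|]; apply: indS.
Qed.

(** * Sets in general position and their extension by a point *)

Lemma general_positionS X Y : Y `<=` X -> general_position X ->
  general_position Y.
Proof. by move=> YX gpX S SY; apply: gpX; apply: fsubset_trans YX. Qed.

Lemma general_position0 : general_position (fset0 : {fset 'rV[R]_d}).
Proof. by move=> S /[!fsubset0]/eqP-> _ c _ _ x; rewrite inE. Qed.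

Lemma general_position_card_affine_span_le S Z :
  general_position Z -> (#|` S| <= d)%N ->
  (#|` [fset z in Z | `[< in_affine_span S z >]]| <= d)%N.
Proof.
move=> gpZ leSd; set B := [fset z in Z | _]; rewrite leqNgt; apply/negP => ltdB.
have [|B' B'B cardB'] := @exists_fsubset_card _ B (#|` S|).+1.
  by rewrite (leq_ltn_trans leSd).
have B'P z : z \in B' -> z \in Z /\ in_affine_span S z.
  by move/(fsubsetP B'B); rewrite !inE /= => /andP[? /asboolP].
have : (#|` B'| <= #|` S|)%N.
  apply: card_affine_span_le => [|z /B'P[]//].
  by apply: gpZ; [apply/fsubsetP => z /B'P[] | rewrite cardB'].
by rewrite cardB' ltnn.
Qed.

(** Only test sets containing [z] are new. Removing [z] from one leaves at most [d] points of [Y],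
    hence the bound [d] rather than [d + 1]. *)
Lemma general_positionU1 Y z : general_position Y ->
  (forall S, S `<=` Y -> (#|` S| <= d)%N -> ~ in_affine_span S z) ->
  general_position (z |` Y).
Proof.
move=> gpY zN S SzY leSd.
have SY : S `\ z `<=` Y by rewrite fsubDset.
have [zS|zNS] := boolP (z \in S); last first.
  by apply: gpY => //; rewrite mem_fsetD1 in SY.
have leS'd : (#|` S `\ z| <= d)%N by move: leSd; rewrite (cardfsD1 z) zS.
rewrite -(fsetD1K zS); apply: affinely_independentU1; last exact: zN.
exact/gpY/leqW.
Qed.

Lemma general_position_extend Y Z : (0 < d)%N ->
  general_position Y -> general_position Z ->
  (2 ^ #|` Y| * d < #|` Z|)%N ->
  exists z, [/\ z \in Z, z \notin Y & general_position (z |` Y)].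
Proof.
move=> d_gt0 gpY gpZ ltYZ.
pose bad S := [fset z in Z | `[< in_affine_span S z >]].
pose B := \bigcup_(S <- fpowerset Y | (#|` S| <= d)%N) bad S.
have leB : (#|` B| <= 2 ^ #|` Y| * d)%N.
  apply: leq_trans (card_bigfcup_le _ _ _) _.
  rewrite -card_fpowerset -sum1_size big_distrl /= big_mkcond /=.
  apply: leq_sum => S _; rewrite mul1n.
  by case: ifP => // leSd; apply: general_position_card_affine_span_le.
have /fsubsetPn[z zZ zB] : ~~ (Z `<=` B).
  by apply/negP => /fsubset_leq_card; rewrite leqNgt (leq_ltn_trans leB).
have zN S : S `<=` Y -> (#|` S| <= d)%N -> ~ in_affine_span S z.
  move=> SY leSd zS; case/negP: zB; apply/bigfcupP; exists S.
    by rewrite fpowersetE SY.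
  by rewrite !inE /= zZ; apply/asboolP.
exists z; split=> //; last exact: general_positionU1.
(* As [0 < d], singletons are among the avoided spans, so [z] is new. *)
apply/negP=> zY; apply: (zN [fset z]); last exact: mem_affine_span1.
  by rewrite fsub1set.
by rewrite cardfs1.
Qed.

(** * Subadditivity of [phi] and the pigeonhole principle *)

Lemma leq_card_phi X Y : Y `<=` X -> general_position Y -> (#|` Y| <= phi X)%N.
Proof.
move=> YX gpY; rewrite /phi.
by apply: leq_bigmax_seq; [rewrite fpowersetE | apply/asboolP].
Qed.

Lemma phiP X :
  exists Y, [/\ Y `<=` X, general_position Y & #|` Y| = phi X].
Proof.
rewrite /phi big_seq_cond.
apply: (big_ind (fun n => exists Y, [/\ Y `<=` X, general_position Y & #|` Y| = n])).
- by exists fset0; split; [exact: fsub0set|exact: general_position0|exact: cardfs0].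
- by move=> m n; rewrite /maxn; case: ifP.
- by move=> Y /andP[/[!fpowersetE] YX /asboolP gpY]; exists Y.
Qed.

Lemma phi_fset0 : phi (fset0 : {fset 'rV[R]_d}) = 0%N.
Proof.
have [Y [/[!fsubset0]/eqP-> _ <-]] := phiP fset0.
exact: cardfs0.
Qed.

Lemma phi_fsetU X Y : (phi (X `|` Y) <= phi X + phi Y)%N.
Proof.
have [Z [ZXY gpZ <-]] := phiP (X `|` Y).
have -> : Z = (Z `&` X) `|` (Z `&` Y) by rewrite -fsetIUr; apply/esym/fsetIidPl.
apply: leq_trans (leq_card_fsetU _ _) _.
by apply: leq_add; apply: leq_card_phi (fsubsetIr _ _) _;
  apply: general_positionS gpZ; apply: fsubsetIl.
Qed.

Lemma phi_bigfcup (I : Type) (r : seq I) (P : pred I) (X : I -> {fset 'rV[R]_d}) :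
  (phi (\bigcup_(i <- r | P i) X i) <= \sum_(i <- r | P i) phi (X i))%N.
Proof.
elim/big_rec2: _ => [|i k A _ le_A]; first by rewrite phi_fset0.
by rewrite (leq_trans (phi_fsetU _ _)) // leq_add2l.
Qed.

Lemma phi_bigfcup_pigeonhole (I : finType) (J : {set I})
    (X : I -> {fset 'rV[R]_d}) (N : nat) : J != set0 ->
  (#|J| * N <= phi (\bigcup_(i in J) X i))%N ->
  exists2 j, j \in J & (N <= phi (X j))%N.
Proof.
move=> /set0Pn[j0 j0J] leN; apply/exists_inP; apply: contraLR leN.
rewrite negb_exists_in -ltnNge => /forall_inP ltN.
apply: leq_ltn_trans (phi_bigfcup _ _ _) _.
(* The term at [j0] makes the comparison of sums strict. *)
rewrite -sum_nat_const !(bigD1 j0 j0J) /= -addSn leq_add //.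
  by rewrite ltnNge ltN.
by apply: leq_sum => i /andP[iJ _]; rewrite ltnW // ltnNge ltN.
Qed.

End GeneralPositionTheory.

Theorem theorem1p1 (R : realType) (d : nat) (hd : (1 <= d)%N) :
  exists f : nat -> nat,
    forall (m : nat) (X : 'I_m -> {fset 'rV[R]_d}),
      (forall I : {set 'I_m}, I != set0 ->
         (f #|I| <= phi (\bigcup_(i in I) X i))%N) ->
      has_general_position_representatives X.
Proof.
exists (fun k => k * (2 ^ k * d).+1)%N => m X phiX.
(* Induction on the set of indices served so far; values of [x] outside [J] are arbitrary. *)
suff rep n (J : {set 'I_m}) : #|J| = n ->
    exists x : 'I_m -> 'rV[R]_d,
      [/\ {in J, forall i, x i \in X i}, {in J &, injective x}
        & general_position [fset x i | i in J]].
  have [x [xX injx gpx]] := rep _ [set: 'I_m] erefl.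
  exists x; split=> [i|i j|]; [exact: xX|exact: injx|].
  by congr general_position: gpx; apply: eq_imfset => // i; rewrite !inE.
elim: n J => [|n IHn] J cardJ.
  have J0 i : i \in J = false by rewrite (cards0_eq cardJ) inE.
  exists (fun=> 0); split=> [i|i j|]; rewrite ?J0 //.
  by apply: general_positionS general_position0;
    apply/fsubsetP => y /imfsetP[i /=]; rewrite J0.
have J_neq0 : J != set0 by rewrite -card_gt0 cardJ.
have [j jJ lej] := phi_bigfcup_pigeonhole J_neq0 (phiX J J_neq0).
have [|x [xX injx gpx]] := IHn (J :\ j).
  by move: cardJ; rewrite (cardsD1 j) jJ => -[].
have [Z [ZXj gpZ cardZ]] := phiP (X j).
set Y := [fset x i | i in J :\ j] in gpx.
have [|z [zZ zY gpz]] := general_position_extend hd gpx gpZ.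
  rewrite cardZ (leq_trans _ lej) // ltnS leq_mul2r leq_exp2l // orbC.
  by rewrite (leq_trans (leq_imfset_card _ _ _)) // -cardE subset_leq_card // subD1set.
have xY i : i \in J -> i != j -> x i \in Y.
  by move=> iJ ij; apply/imfsetP; exists i; rewrite //= !inE ij.
exists (fun i => if i == j then z else x i); split.
- move=> i iJ; case: eqVneq => [->|ij]; first exact: (fsubsetP ZXj).
  by apply: xX; rewrite !inE ij.
- move=> i k iJ kJ; case: eqVneq => [->|ij]; case: eqVneq => [->|kj] //.
  + by move=> zx; rewrite zx xY in zY.
  + by move=> xz; rewrite -xz xY in zY.
  + by apply: injx; rewrite !inE ?ij ?kj.
- apply: general_positionS gpz; apply/fsubsetP => y /imfsetP[i /= iJ ->].
  rewrite in_fset1U; have [_|ij] := eqVneq i j; first by rewrite eqxx.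
  by rewrite xY ?orbT.
Qed.
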